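(* For every rooted tree $T$, the polynomial $P(T)\in\mathbb{Z}[x,y]$ satisfies $$P(T)=\sum_{S\in\mathcal{S}_T} q_T(S),$$ where $\mathcal{S}_T$ is the set of all primary subtrees of $T$ and $q_T(S)$ is the monomial assigned to the primary subtree $S$ of $T$.
   Context: All trees are finite and unlabeled. A rooted tree is a tree with one distinguished vertex (the root); isomorphisms of rooted trees preserve the root. A leaf vertex of a rooted tree is a vertex with no children; all other vertices are internal. Thus the unique vertex of the one-vertex tree $\bullet$ is a leaf vertex, while in a rooted tree with more than one vertex the root is always internal, even if it has degree one. For $k\ge 1$ and rooted trees $T_1,\dots,T_k$, $\wedge_k(T_1,\dots,T_k)$ denotes the rooted tree obtained by pasting the roots of $T_1,\dots,T_k$ to the $k$ leaf vertices of the rooted $k$-star (root with $k$ children), i.e. a new root whose $k$ children are the roots of $T_1,\dots,T_k$. Every rooted tree other than $\bullet$ is of this form, uniquely up to reordering and isomorphism of the $T_i$. The polynomial $P(T)\in\mathbb{Z}[x,y]$ of a rooted tree $T$ is defined recursively by $P(\bullet)=x$ and $P(\wedge_k(T_1,\dots,T_k))=y+\prod_{i=1}^k P(T_i)$ for $k\ge 1$. A primary subtree $S$ of a rooted tree $T$ is a rooted subtree of $T$ (a subgraph that is a tree) having the same root as $T$ and such that every leaf vertex of $T$ is either a leaf vertex of $S$ or a descendant in $T$ of a leaf vertex of $S$. Distinct subgraphs are counted as distinct primary subtrees. For a primary subtree $S$ of $T$, $q_T(S)=x^{\alpha}y^{\beta}$, where $\alpha$ is the number of leaf vertices of $S$ that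 are leaf vertices of $T$ and $\beta$ is the number of leaf vertices of $S$ that are internal vertices of $T$. *)

(* Defs.v *)
From HB Require Import structures.
From mathcomp Require Import mpoly.
From mathcomp Require Import all_boot all_order all_algebra.

Set Implicit Arguments.
Unset Strict Implicit.
Unset Printing Implicit Defensive.

Import GRing.Theory.
Local Open Scope ring_scope.

Section Graph.
Variable V : finType.
Implicit Types (A : {set V}) (e : rel V) (r u v : V).

(* A repetition-free sequence has at most #|V| entries, so the bounded
   quantifiers below lose nothing; see acyclicP and childP. The bound 2 allows
   for [:: u; v], which is a cycle in the sense of ucycle as soon as u and v
   are adjacent. *)
Definition acyclic e : bool :=
  [forall n : 'I_#|V|.+1, forall c : n.-tuple V, ucycleb e c ==> (n <= 2)%N].

Definition is_tree A e : bool :=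
  [forall u in A, forall v in A, connect e u v] && acyclic e.

(* The (unique) simple path from the root r to v ends with the edge u -- v. *)
Definition child e r u v : bool :=
  [exists n : 'I_#|V|, exists p : n.-tuple V,
    [&& path e r (rcons p v), uniq (r :: rcons p v) & last r p == u]].

(* Every vertex is a descendant of itself. *)
Definition descendant e r u v : bool := connect (child e r) u v.

Definition leaves A e r : {set V} := [set v in A | [forall u, ~~ child e r v u]].

Lemma acyclicP e :
  reflect (forall c, ucycle e c -> (size c <= 2)%N) (acyclic e).
Proof.
apply: (iffP forallP) => [H c /andP[cyc Uc] | H n].
  have lt_c : (size c < #|V|.+1)%N by rewrite ltnS -(card_uniqP Uc) max_card.
  have /forallP /(_ (in_tuple c)) /implyP := H (Ordinal lt_c).
  by apply; rewrite /ucycleb cyc.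
by apply/forallP=> c; apply/implyP=> /H; rewrite size_tuple.
Qed.

Lemma childP e r u v :
  reflect (exists p, [/\ path e r (rcons p v), uniq (r :: rcons p v)
                       & last r p = u])
          (child e r u v).
Proof.
apply: (iffP existsP) => [[n /existsP[p /and3P[pP pU /eqP pL]]] | [p [pP pU pL]]].
  by exists p.
have lt_p : (size p < #|V|)%N.
  apply: leq_trans (max_card (mem (r :: rcons p v))).
  by rewrite (card_uniqP pU) /= size_rcons ltnW.
exists (Ordinal lt_p); apply/existsP; exists (in_tuple p).
by rewrite pP pU pL eqxx.
Qed.

Lemma simple_path_unique e r p q :
    symmetric e -> acyclic e ->
    path e r p -> uniq (r :: p) -> path e r q -> uniq (r :: q) ->
  last r p = last r q -> p = q.
Proof.
move=> eC /acyclicP eA; elim: p r q => [|a p IHp] r [|b q] //.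
- by move=> _ _ _ /andP[/negP rq _] /= def_r; case: rq; rewrite def_r mem_last.
- by move=> _ /andP[/negP rp _] _ _ /= def_r; case: rp; rewrite -def_r mem_last.
have [<-{b} | neq_ab] := eqVneq a b.
  move=> /= /andP[_ pP] /andP[_ pU] /andP[_ qP] /andP[_ qU] pq.
  by rewrite (IHp a q).
move=> pP pU qP qU pq; case/negP: neq_ab.
have q_p : has (mem (a :: p)) (b :: q).
  apply/hasP; exists (last b q); first exact: mem_last.
  by move: pq => /= <-; apply: mem_last.
have [z [q1 [q2 [Eq q1_p]]]] : exists z q1 q2,
    b :: q = rcons q1 z ++ q2 /\ (z \in a :: p) && ~~ has (mem (a :: p)) q1.
  by case: (split_find q_p) => z q1 q2 z_p q1_p; exists z, q1, q2; rewrite q1_p andbT.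
case/andP: q1_p => /splitPr Ep; case def_p: _ / Ep => [p1 p2].
rewrite has_sym /= has_cat /= !negb_or => /and3P[q1p1 zq1 _].
move: pP pU qP qU; rewrite Eq def_p -cat_rcons !cat_path -!cat_cons !cat_uniq.
case/andP=> p1P _ /andP[p1U _] /andP[q1P _] /andP[q1U _].
have cP : path e r (rcons p1 z ++ rev (r :: q1)).
  rewrite cat_path p1P last_rcons /=.
  move: q1P; rewrite -rev_path last_rcons belast_rcons.
  by rewrite (eq_path (e' := e)) // => i j; apply: eC.
have cU : ucycle e (r :: rcons p1 z ++ rev q1).
  apply/andP; split; first by rewrite /= rcons_cat -rev_cons.
  rewrite -cat_cons cat_uniq p1U rev_uniq.
  move: q1U; rewrite /= mem_rcons inE rcons_uniq negb_or => /and3P[/andP[rz rq1] _ ->].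
  rewrite andbT has_rev; apply/hasPn=> x xq1 /=.
  rewrite inE mem_rcons inE; apply/negP=> /or3P[/eqP Ex|/eqP Ex|xp1].
  - by rewrite -Ex xq1 in rq1.
  - by move: zq1; rewrite /= -Ex xq1.
  - by case/hasP: q1p1; exists x.
have := eA _ cU; rewrite /= size_cat size_rcons size_rev.
case: p1 q1 Eq def_p {p1P p1U q1P q1U q1p1 zq1 cP cU} => [|? ?] [|? ?] //=; last 1 first.
by case=> -> _ [-> _].
Qed.

End Graph.

Record rootedTree := RootedTree {
  vertex :> finType;
  adj : rel vertex;
  root : vertex;
  adj_sym : symmetric adj;
  adj_irr : irreflexive adj;
  adj_tree : is_tree [set: vertex] adj
}.

Arguments adj : clear implicits.
Arguments root : clear implicits.

Definition rtree_child (T : rootedTree) : rel T := child (adj T) (root T).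
Definition rtree_leaves (T : rootedTree) : {set T} :=
  leaves [set: T] (adj T) (root T).

Definition rtree_iso (T1 T2 : rootedTree) : Prop :=
  exists f : T1 -> T2, [/\ bijective f, f (root T1) = root T2
                         & forall u v, adj T2 (f u) (f v) = adj T1 u v].

Lemma bullet_subproof : is_tree [set: unit] (fun _ _ : unit => false).
Proof.
apply/andP; split; first by do 2![apply/forall_inP=> -[] _]; rewrite connect0.
by apply/acyclicP=> -[|a [|b [|? ?]]].
Qed.

Definition bullet : rootedTree :=
  @RootedTree unit (fun _ _ => false) tt (fun _ _ => erefl) (fun _ => erefl)
    bullet_subproof.

Section Wedge.
Variables (k : nat) (Ts : 'I_k -> rootedTree).

(* None is the new root, and Some (Tagged _ v) is the vertex v of Ts i. *)
Definition wedge_vertex : finType := option {i : 'I_k & Ts i}.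

Definition wedge_adj : rel wedge_vertex := fun a b =>
  match a, b with
  | None, None => false
  | None, Some s | Some s, None => tagged s == root (Ts (tag s))
  | Some s, Some t =>
      (tag s == tag t) && adj (Ts (tag s)) (tagged s) (tagged_as s t)
  end.

Definition wedge_in i (v : Ts i) : wedge_vertex := Some (Tagged Ts v).

Lemma wedge_in_inj i : injective (@wedge_in i).
Proof. by move=> u v [] /eqP; rewrite -tag_eqE /tag_eq eqxx tagged_asE => /eqP. Qed.

Lemma wedge_adj_sym : symmetric wedge_adj.
Proof.
move=> [[i u]|] [[j v]|] //=; have [eq_ij | //] := eqVneq i j.
by case: j / eq_ij v => v /=; rewrite !tagged_asE adj_sym.
Qed.

Lemma wedge_adj_irr : irreflexive wedge_adj.
Proof. by move=> [[i u]|] //=; rewrite eqxx tagged_asE adj_irr. Qed.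

Lemma wedge_path_in i (u : Ts i) (p : seq wedge_vertex) :
  path wedge_adj (wedge_in u) p -> None \notin p ->
  exists2 q, path (adj (Ts i)) u q & p = map (@wedge_in i) q.
Proof.
elim: p u => [|[[j v]|] p IHp] u /=; [by exists [::] | | by []].
case/andP=> /andP[/eqP eq_ij]; case: j / eq_ij v => v.
rewrite tagged_asE => uv vp pN.
by have [q vq ->] := IHp v vp pN; exists (v :: q); rewrite //= uv.
Qed.

Lemma path_wedge_in i (u : Ts i) q :
  path wedge_adj (wedge_in u) (map (@wedge_in i) q) = path (adj (Ts i)) u q.
Proof.
by elim: q u => //= v q IHq u; rewrite -IHq eqxx tagged_asE.
Qed.

Lemma wedge_connect_in i (u v : Ts i) :
  connect wedge_adj (wedge_in u) (wedge_in v).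
Proof.
have /andP[/forall_inP/(_ u (in_setT u))/forall_inP/(_ v (in_setT v)) uv _] :=
  adj_tree (Ts i).
case/connectP: uv => p up ->; apply/connectP; exists (map (@wedge_in i) p).
  by rewrite path_wedge_in.
by rewrite last_map.
Qed.

Lemma wedge_is_tree : is_tree [set: wedge_vertex] wedge_adj.
Proof.
have eC := sym_connect_sym wedge_adj_sym.
have toN a : connect wedge_adj None a.
  case: a => [[i v]|]; last exact: connect0.
  apply: connect_trans (wedge_connect_in (root (Ts i)) v).
  by apply: connect1; rewrite /= eqxx.
apply/andP; split.
  apply/forall_inP=> a _; apply/forall_inP=> b _.
  by apply: connect_trans (toN b); rewrite eC.
apply/acyclicP=> c Uc; have [/rot_to[n c' Ec] | cN] := boolP (None \in c).
  rewrite -(size_rot n) Ec; move: Uc; rewrite -(rot_ucycle n) Ec {c Ec}.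
  case/andP; case: c' => [|[[i v]|] c] //= /andP[/eqP Ev].
  rewrite rcons_path => /andP[cP cL] /andP[cN /andP[vc _]].
  have [q vq Eq] := wedge_path_in cP cN; move: cL vc.
  rewrite Eq (last_map (@wedge_in i)) /= => /eqP Eq'.
  rewrite (mem_map (@wedge_in_inj i)).
  case: q {vq Eq} Eq' => //= w q Eq'.
  by rewrite Ev /= -Eq' mem_last.
case: c Uc cN => [|[[i v]|] c] // /andP[cP cU] cN.
have cN' : None \notin rcons c (wedge_in v).
  by move: cN; rewrite mem_rcons !inE.
have [q vq Eq] := wedge_path_in cP cN'.
case/lastP: q => [|q w] in vq Eq *; first by case: (c) Eq.
rewrite map_rcons in Eq; case/rcons_inj: Eq => Ec Ew.
have {}Ew : v = w by apply: wedge_in_inj; congr Some.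
rewrite -{w}Ew in vq; have /andP[_ /acyclicP eA] := adj_tree (Ts i).
rewrite Ec /= size_map; apply: (eA (v :: q)).
apply/andP; split=> //.
by rewrite -(map_inj_uniq (@wedge_in_inj i)) /= -Ec.
Qed.

(* For k = 0 this is the one-vertex tree. *)
Definition wedge : rootedTree :=
  @RootedTree wedge_vertex wedge_adj None wedge_adj_sym wedge_adj_irr
    wedge_is_tree.

End Wedge.

Notation ZXY := {mpoly int[2]}.
Definition varx : ZXY := 'X_ord0.
Definition vary : ZXY := 'X_ord_max.

(* tree_poly_at T n v is the polynomial of the subtree formed by v and its
   descendants, provided that n exceeds the height of that subtree. *)
Fixpoint tree_poly_at (T : rootedTree) (n : nat) (v : T) : ZXY :=
  if n is n'.+1 then
    if v \in rtree_leaves T then varx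
    else vary + \prod_(u | rtree_child v u) tree_poly_at n' u
  else 0.

(* The polynomial P(T). The defining recursion is proved below, as
   tree_poly_bullet, tree_poly_wedge and tree_poly_iso. *)
Definition tree_poly (T : rootedTree) : ZXY := tree_poly_at #|T| (root T).

Lemma tree_poly_at_fuel (T : rootedTree) n m (v : T) p :
    path (adj T) (root T) p -> uniq (root T :: p) -> last (root T) p = v ->
    (#|T| <= n + size p)%N -> (#|T| <= m + size p)%N ->
  tree_poly_at n v = tree_poly_at m v.
Proof.
have lt_p q : uniq (root T :: q) -> (#|T| <= 0 + size q)%N = false.
  by move=> Uq; rewrite leqNgt -[(_ < _)%N]/(size (root T :: q) <= #|T|)%N
                        -(card_uniqP Uq) max_card.
elim: n m v p => [|n IHn] m v p pP pU pL; first by rewrite lt_p.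
case: m => [_|m]; first by rewrite lt_p.
move=> le_n le_m /=; case: ifP => // _; congr (vary + _).
apply: eq_bigr => u /childP[q [qP qU qL]].
have Eq : q = p.
  have /andP[_ eA] := adj_tree T.
  move: (qP) (qU); rewrite rcons_path -rcons_cons rcons_uniq => /andP[qP' _] /andP[_ qU'].
  by apply: (simple_path_unique (@adj_sym T) eA qP' qU' pP pU); rewrite qL pL.
rewrite Eq in qP qU.
by apply: (IHn m u _ qP qU); rewrite ?last_rcons // size_rcons addnS -addSn.
Qed.

Lemma tree_poly_atE (T : rootedTree) n :
  (#|T| <= n)%N -> tree_poly_at n (root T) = tree_poly T.
Proof.
by move=> le_n; apply: (@tree_poly_at_fuel _ _ _ _ [::]); rewrite ?addn0.
Qed.

Lemma tree_poly_bullet : tree_poly bullet = varx.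
Proof.
rewrite /tree_poly card_unit /= inE in_setT /=.
case: forallP => // -[] u; apply/negP => /childP[p []].
by rewrite rcons_path andbF.
Qed.

Lemma tree_poly_iso (T1 T2 : rootedTree) :
  rtree_iso T1 T2 -> tree_poly T1 = tree_poly T2.
Proof.
case=> f [bij_f f_root f_adj]; rewrite /tree_poly (bij_eq_card bij_f) -f_root.
have f_inj := bij_inj bij_f; have [g fK gK] := bij_f.
have f_path u p : path (adj T2) (f u) (map f p) = path (adj T1) u p.
  by elim: p u => //= v p IHp u; rewrite f_adj IHp.
have f_child u v : rtree_child (f u) (f v) = rtree_child u v.
  apply/childP/childP=> -[p [pP pU pL]].
    have [q Ep] : exists q, p = map f q by exists (map g p); rewrite mapK.
    exists q; move: pP pU pL; rewrite {p}Ep -f_root -map_rcons f_path -map_cons last_map.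
    by rewrite (map_inj_uniq f_inj) => ? ? /f_inj ->.
  exists (map f p); rewrite -f_root -map_rcons f_path -map_cons last_map.
  by rewrite (map_inj_uniq f_inj) pL.
have f_leaf v : (f v \in rtree_leaves T2) = (v \in rtree_leaves T1).
  rewrite !inE; apply/forallP/forallP=> H u.
    by rewrite -[child _ _ _ _]f_child; apply: H.
  by rewrite -(gK u) [child _ _ _ _]f_child; apply: H.
move: #|T2| (root T1) => n; elim: n => //= n IHn v.
rewrite f_leaf; case: ifP => // _; congr (vary + _).
rewrite [RHS](reindex f) /=; last by apply: onW_bij.
by apply: eq_big => [u | u _]; rewrite ?f_child // IHn.
Qed.

Lemma tree_poly_wedge (k : nat) (Ts : 'I_k -> rootedTree) :
  (0 < k)%N -> tree_poly (wedge Ts) = vary + \prod_(i < k) tree_poly (Ts i).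
Proof.
move=> k_gt0.
have child_in i (u v : Ts i) :
    @rtree_child (wedge Ts) (wedge_in u) (wedge_in v) = rtree_child u v.
  apply/childP/childP=> -[p [pP pU pL]]; last first.
    exists (wedge_in (root (Ts i)) :: map (@wedge_in _ Ts i) p).
    have -> : rcons (wedge_in (root (Ts i)) :: map (@wedge_in _ Ts i) p)
                (wedge_in v) = map (@wedge_in _ Ts i) (root (Ts i) :: rcons p v).
      by rewrite /= map_rcons.
    split; first by rewrite /= path_wedge_in eqxx.
      rewrite cons_uniq (map_inj_uniq (@wedge_in_inj _ Ts i)) pU andbT.
      by apply/mapP=> -[].
    by rewrite /= (last_map (@wedge_in _ Ts i)) pL.
  case: p pP pU pL => [|[[j w]|] p] //= /andP[/eqP Ew pP].
  case/and3P=> pN wp pU pL.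
  have [q qP Eq] := wedge_path_in pP pN.
  case/lastP: q => [|q w'] in qP Eq *; first by case: (p) Eq.
  rewrite map_rcons in Eq; move/rcons_inj: Eq => Eq.
  have /= Ep := congr1 fst Eq; have /= Ew' := congr1 snd Eq => {Eq}.
  have Eij : i = j by case: Ew'.
  case: j / Eij in w q w' Ew qP Ep Ew' pP pN wp pL *.
  have {}Ew' := @wedge_in_inj _ Ts i _ _ Ew'.
  rewrite -{w'}Ew' in qP; exists q; rewrite -Ew /=; split=> //.
    move: wp pU; rewrite Ep -map_rcons -[Some _]/(wedge_in w) 
            (mem_map (@wedge_in_inj _ Ts i)).
    by rewrite (map_inj_uniq (@wedge_in_inj _ Ts i)) => -> ->.
  by apply: (@wedge_in_inj _ Ts i); rewrite -last_map -Ep.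
have child_toN (a : wedge Ts) : ~~ rtree_child a None.
  by apply/negP=> /childP[p [_]]; rewrite /= mem_rcons inE eqxx.
have child_diff i j (u : Ts i) (v : Ts j) :
    @rtree_child (wedge Ts) (wedge_in u) (wedge_in v) -> i = j.
  case/childP=> p [pP _ pL]; move: pP; rewrite rcons_path pL.
  by case/andP=> _ /= /andP[/eqP].
have child_N i (v : Ts i) :
    @rtree_child (wedge Ts) None (wedge_in v) = (v == root (Ts i)).
  apply/childP/eqP=> [[p [pP pU pL]] | ->]; last first.
    by exists [::]; rewrite /= eqxx.
  by move: pP; rewrite rcons_path [last _ _]pL => /andP[_ /= /eqP].
have leaf_in i (v : Ts i) :
    (wedge_in v \in rtree_leaves (wedge Ts)) = (v \in rtree_leaves (Ts i)).
  rewrite !inE; apply/forallP/forallP=> H u.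
    by rewrite -[child _ _ _ _]child_in; apply: H.
  case: u => [[j u]|]; last exact: child_toN.
  apply/negP=> uv; have Eij := child_diff _ _ _ _ uv.
  by case: j / Eij u uv => u; rewrite [child _ _ _ _]child_in; apply/negP/H.
have poly_in n i (v : Ts i) :
    @tree_poly_at (wedge Ts) n (wedge_in v) = tree_poly_at n v.
  elim: n v => //= n IHn v; rewrite leaf_in; case: ifP => // _; congr (vary + _).
  rewrite -(eq_bigr _ (fun u _ => IHn u)).
  rewrite -(big_imset (fun b => @tree_poly_at (wedge Ts) n b)
                      (h := @wedge_in _ Ts i)); last first.
    by move=> u w _ _; apply: (@wedge_in_inj _ Ts i).
  apply: eq_bigl => -[[j u]|]; last first.
    by rewrite (negPf (child_toN _)); apply/esym/negP=> /imsetP[].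
  apply/idP/imsetP=> [uv | [w vw ->]]; last by rewrite child_in.
  have Eij := child_diff _ _ _ _ uv.
  by case: j / Eij u uv => u uv; exists u; rewrite // -[_ \in _]child_in.
have cards i : (#|Ts i| <= #|{: {i & Ts i}}|)%N.
  apply: (leq_card (fun v => Tagged Ts v)) => u v E.
  by apply: (@wedge_in_inj _ Ts i); congr Some.
rewrite /tree_poly [#|_|]card_option /=.
move: #|_| cards => n cards.
rewrite inE in_setT /=; case: forallP => [/(_ (wedge_in (root (Ts (Ordinal k_gt0)))))|_].
  by rewrite [child _ _ _ _]child_N eqxx.
congr (vary + _).
transitivity (\prod_(i < k) @tree_poly_at (wedge Ts) n (wedge_in (root (Ts i)))).
  rewrite -(big_imset (fun b => @tree_poly_at (wedge Ts) n b)
                      (h := fun i => wedge_in (root (Ts i)))); last first.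
    by move=> i j _ _ [].
  apply: eq_bigl => -[[i v]|].
    rewrite [LHS]child_N; apply/eqP/imsetP=> [-> | [j _ E]]; first by exists i.
    case: E => Eij; case: j / Eij => Ev.
    by apply: (@wedge_in_inj _ Ts i); congr Some.
  rewrite [LHS](_ : _ = false); first by apply/esym/imsetP=> -[].
  exact: negPf (child_toN _).
by apply: eq_bigr => i _; rewrite poly_in tree_poly_atE.
Qed.

Section PrimarySubtrees.
Variable T : rootedTree.

(* A set of vertices and a set of edges, an edge being an unordered pair. *)
Definition subgraph : predArgType := ({set T} * {set {set T}})%type.

Implicit Type S : subgraph.

Definition is_subgraph S : bool :=
  [forall E in S.2, exists u in S.1, exists v in S.1,
    adj T u v && (E == [set u; v])].

Definition sub_adj S : rel T := fun u v => [set u; v] \in S.2.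

Definition sub_leaves S : {set T} := leaves S.1 (sub_adj S) (root T).

Definition primary S : bool :=
  [&& is_subgraph S, is_tree S.1 (sub_adj S), root T \in S.1
    & [forall v in rtree_leaves T,
        (v \in sub_leaves S)
        || [exists u in sub_leaves S, descendant (adj T) (root T) u v]]].

Definition primary_subtrees : {set subgraph} := [set S | primary S].

Definition subtree_monomial S : ZXY :=
  varx ^+ #|sub_leaves S :&: rtree_leaves T|
  * vary ^+ #|sub_leaves S :\: rtree_leaves T|.

End PrimarySubtrees.

Arguments primary_subtrees : clear implicits.

(* Main.v *)
Require Import Defs.
From mathcomp Require Import mpoly.
From mathcomp Require Import all_boot all_order all_algebra.

(** Cut the tree off below some internal vertices: a primary subtree S is
    recovered from the set B of those of its vertices that keep their children.
    Being primary means exactly that a vertex of S keeps either all of its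
    children or none of them. If a child z of an inner vertex u were dropped,
    take a leaf of the whole tree below z; a leaf of S above it would have to
    be u or an ancestor of u, and these are not leaves of S. Hence primary
    subtrees correspond to ideals: sets B of internal vertices that contain the
    parent of each of their members other than the root ([subtree_of_primary],
    [subtree_of_inner], [inner_subtree_of]). The vertices of S are the root and the children of B
    ([reached B]), and its leaves are those that are not in B ([frontier B]).

    It remains to show that P at the root is the sum over all ideals B of the
    product over the frontier of B of the weights x (leaf) or y (internal vertex)
    ([root_ideal_sum]). Unfold the recursion one vertex at a time. When
    the unfolded vertices form a parent-closed set U, P at the root is the sum
    over the ideals B inside U of a product over the frontier of B, in which a
    vertex z contributes its weight if it lies in U and the still folded P(z)
    otherwise. Unfolding one more vertex v replaces P(v) by its weight plus,
    if v is internal, the product of P over the children of v. The first term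
    is the contribution of B, and the second that of B with v added, whose
    frontier has v replaced by its children ([explored_sumU1]). *)

Set Implicit Arguments.
Unset Strict Implicit.
Unset Printing Implicit Defensive.

Import GRing.Theory.
Local Open Scope ring_scope.

(** * Parents and children in a rooted tree *)

Section RootedTree.
Variable T : rootedTree.
Implicit Types (u v z : T) (U A B : {set T}) (S : subgraph T).

Local Notation r := (Defs.root T).
Local Notation chd := (@rtree_child T).

Lemma simple_path_to v :
  exists p, [/\ path (adj T) r p, uniq (r :: p) & last r p = v].
Proof.
have /andP[/forall_inP/(_ r (in_setT r))/forall_inP/(_ v (in_setT v)) rv _] :=
  adj_tree T.
case/connectP: rv => p rp ->; case/shortenP: rp => q rq Uq _.
by exists q.
Qed.

Lemma simple_path_to_unique p q :
    path (adj T) r p -> uniq (r :: p) -> path (adj T) r q -> uniq (r :: q) ->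
  last r p = last r q -> p = q.
Proof.
by apply: simple_path_unique; [exact: adj_sym | have /andP[] := adj_tree T].
Qed.

Lemma child_adj u v : chd u v -> adj T u v.
Proof. by case/childP=> p [pP _ <-]; move: pP; rewrite rcons_path => /andP[]. Qed.

Lemma child_root u : chd u r = false.
Proof. by apply/childP=> -[p []]; rewrite /= mem_rcons inE eqxx. Qed.

Lemma parent_unique u u' v : chd u v -> chd u' v -> u = u'.
Proof.
case/childP=> p [pP pU <-] /childP[q [qP qU <-]].
have /rcons_inj[-> //] : rcons p v = rcons q v.
by apply: simple_path_to_unique; rewrite ?last_rcons.
Qed.

(** Neither relation holding, the simple path to each endpoint passes through the
    other one; each path is then a prefix of the other, and u = v. *)
Lemma adj_child u v : adj T u v -> chd u v || chd v u.
Proof.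
move=> uv; apply/norP=> -[Nuv Nvu].
have [p [pP pU pu]] := simple_path_to u; have [q [qP qU qv]] := simple_path_to v.
have on_path a b s : adj T a b -> ~~ chd a b -> path (adj T) r s ->
    uniq (r :: s) -> last r s = a -> b \in r :: s.
  move=> ab Nab sP sU sa; apply: contraNT Nab => Nb; apply/childP; exists s.
  by rewrite rcons_path sP sa ab -rcons_cons rcons_uniq Nb sU.
have longer a s t : path (adj T) r s -> uniq (r :: s) -> last r s = a ->
    path (adj T) r t -> uniq (r :: t) -> a \in r :: t ->
    exists t', t = s ++ t'.
  move=> sP sU sa tP tU /splitPl def_t.
  case: def_t tP tU => t1 t2 t1a; rewrite cat_path -cat_cons cat_uniq.
  case/andP=> t1P _ /andP[t1U _]; exists t2; congr cat.
  by apply: simple_path_to_unique; rewrite ?t1a.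
have vu : adj T v u by rewrite adj_sym.
have [s Eq] := longer u p q pP pU pu qP qU (on_path v u q vu Nvu qP qU qv).
have [t Ep] := longer v q p qP qU qv pP pU (on_path u v p uv Nuv pP pU pu).
have s0 : s = [::].
  apply/nilP; move: (congr1 size Ep); rewrite Eq !size_cat -addnA /nilp => /eqP.
  by rewrite -{1}[size p]addn0 eqn_add2l eq_sym addn_eq0 => /andP[].
by move: uv; rewrite -pu -qv Eq s0 cats0 adj_irr.
Qed.

Lemma root_ind (Q : T -> Prop) :
  Q r -> (forall u v, chd u v -> Q u -> Q v) -> forall v, Q v.
Proof.
move=> Qr Qc v; have [p [pP pU <-]] := simple_path_to v.
elim/last_ind: p pP pU => // p a IHp pP pU; rewrite last_rcons.
apply: (Qc (last r p)); first by apply/childP; exists p.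
move: pP pU; rewrite rcons_path -rcons_cons rcons_uniq.
by case/andP=> pP _ /andP[_ pU]; apply: IHp.
Qed.

(** Passing from a vertex to a child lengthens its simple path from the root, and
    a simple path has fewer than #|T| edges. *)
Lemma leaf_ind (Q : T -> Prop) :
  (forall v, (forall u, chd v u -> Q u) -> Q v) -> forall v, Q v.
Proof.
move=> Qc v; have [p [pP pU pv]] := simple_path_to v.
have [n] : exists n, (#|T| <= n + size p)%N by exists #|T|; apply: leq_addr.
elim: n v p pP pU pv => [|n IHn] v p pP pU pv le_n.
  move: le_n; rewrite leqNgt -[(_ < _)%N]/(size (r :: p) <= #|T|)%N.
  by rewrite -(card_uniqP pU) max_card.
apply: Qc => u /childP[q [qP qU qv]].
have Eq : q = p.
  move: (qP) (qU); rewrite rcons_path -rcons_cons rcons_uniq.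
  case/andP=> qP' _ /andP[_ qU'].
  by apply: simple_path_to_unique; rewrite ?qv.
rewrite Eq in qP qU.
by apply: (IHn u _ qP qU); rewrite ?last_rcons // size_rcons addnS -addSn.
Qed.

Lemma child_irr v : chd v v = false.
Proof. by apply/idP=> /child_adj; rewrite adj_irr. Qed.

Lemma leafP v : reflect (forall u, ~~ chd v u) (v \in rtree_leaves T).
Proof. by rewrite !inE; apply: forallP. Qed.

Lemma internalP v : reflect (exists u, chd v u) (v \notin rtree_leaves T).
Proof.
rewrite !inE negb_forall; apply: (iffP existsP) => -[u vu]; exists u => //.
  exact: negbNE.
by rewrite negbK.
Qed.

(** Every subtree has height less than #|T|, so the same fuel can be used on both
    sides of the recursion. *)
Lemma tree_poly_at_rec v :
  tree_poly_at #|T| v =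
    if v \in rtree_leaves T then varx
    else vary + \prod_(u | chd v u) tree_poly_at #|T| u.
Proof.
have [p [pP pU pv]] := simple_path_to v.
rewrite (tree_poly_at_fuel (m := #|T|.+1) pP pU pv) ?leq_addr //.
by rewrite addSn leqW // leq_addr.
Qed.

(** * Ideals of internal vertices and their frontiers *)

(** The root counts as reached from outside, so that [B \subset reached B] says
    that B is closed under taking parents; for the empty B the only reached
    vertex is the root, as in the one-vertex subtree. *)
Definition reached B : {set T} :=
  [set v | (v == r) || [exists u in B, chd u v]].

Definition frontier B : {set T} := reached B :\: B.

Definition ideal B : bool :=
  (B \subset reached B) && [disjoint B & rtree_leaves T].

Lemma reached_root B : r \in reached B.
Proof. by rewrite inE eqxx. Qed.

Lemma reached_child B u v : chd u v -> (v \in reached B) = (u \in B).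
Proof.
move=> uv; rewrite inE; have [v_r | _] /= := eqVneq v r.
  by rewrite v_r child_root in uv.
apply/exists_inP/idP => [[u' u'B u'v] | uB]; last by exists u.
by rewrite (parent_unique uv u'v).
Qed.

Lemma reachedP B v :
  reflect (v = r \/ exists2 u, u \in B & chd u v) (v \in reached B).
Proof.
rewrite inE; apply: (iffP orP) => -[].
- by move/eqP; left.
- by case/exists_inP=> u; right; exists u.
- by move->; left.
- by case=> u uB uv; right; apply/exists_inP; exists u.
Qed.

Lemma reachedS A B : A \subset B -> reached A \subset reached B.
Proof.
move=> /subsetP sAB; apply/subsetP=> v /reachedP[-> | [u uA uv]].
  exact: reached_root.
by rewrite (reached_child _ uv) sAB.
Qed.

Lemma reachedU1 B v : reached (v |: B) = reached B :|: [set u | chd v u].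
Proof.
apply/setP=> u; apply/reachedP/setUP => [[-> | [z]] | [/reachedP[-> | [z zB zu]] |]].
- by left; apply: reached_root.
- case/setU1P=> [-> vu | zB zu]; first by right; rewrite inE.
  by left; rewrite (reached_child _ zu).
- by left.
- by right; exists z; rewrite // setU1r.
- by rewrite inE => vu; right; exists v; rewrite // setU11.
Qed.

(** * Unfolding the recursion one vertex at a time *)

Section Grow.
Variables (U : {set T}) (v : T).
Hypotheses (U_closed : U \subset reached U) (vU : v \notin U).

Lemma childU u : chd v u -> u \notin U.
Proof.
move=> vu; apply: contra vU => /(subsetP U_closed).
by rewrite (reached_child _ vu).
Qed.

(** No member of B is a child of v, so adding v creates no new parent for the
    members of B: only the conditions on v itself are added. *)
Lemma idealU1 B : B \subset U ->
  ideal (v |: B) = [&& ideal B, v \in frontier B & v \notin rtree_leaves T].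
Proof.
move=> sBU; have vB : v \notin B by apply: contra vU; apply: (subsetP sBU).
have E : (v |: B \subset reached (v |: B))
           = (B \subset reached B) && (v \in reached B).
  rewrite subUset sub1set andbC reachedU1; congr andb.
    apply/subsetP/subsetP=> H u uB; last by rewrite inE H.
    case/setUP: (H u uB) => //; rewrite inE => vu.
    by case/negP: (childU vu); apply: (subsetP sBU).
  by rewrite !inE child_irr orbF.
rewrite /ideal E [frontier B]/frontier in_setD vB /=.
rewrite -!setI_eq0 setIUl setU_eq0 !setI_eq0 disjoints1.
by rewrite -!andbA; do !bool_congr.
Qed.

Lemma frontierU1 B : B \subset U -> v \in frontier B ->
  frontier (v |: B) = (frontier B :\ v) :|: [set u | chd v u].
Proof.
move=> sBU; rewrite inE => /andP[vB _].
apply/setP=> u; rewrite /frontier reachedU1 !in_setD !in_setU !in_setD !in_set1.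
rewrite [u \in finset _]inE.
have [vu | _] := boolP (chd v u); last by rewrite !orbF negb_or andbA.
have uB : u \notin B by apply: contra (childU vu); apply: (subsetP sBU).
by rewrite !orbT andbT negb_or uB andbT; apply: contraTneq vu => ->; rewrite child_irr.
Qed.

(** Splitting the ideals B' inside [v |: U] according to whether they contain v,
    and writing those that do as [v |: B]. *)
Lemma sum_subsetU1 (R : nmodType) (F : {set T} -> R) :
  \sum_(B : {set T} | (B \subset v |: U) && ideal B) F B =
    \sum_(B : {set T} | (B \subset U) && ideal B)
       (F B + if (v \in frontier B) && (v \notin rtree_leaves T)
              then F (v |: B) else 0).
Proof.
have subU1 B : v \notin B -> (B \subset v |: U) = (B \subset U).
  move=> vB; rewrite -subDset (_ : B :\: [set v] = B) //.
  by apply/setDidPl; rewrite disjoint_sym disjoints1.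
have nsubU B : v \in B -> (B \subset U) = false.
  by move=> vB; apply/negbTE/subsetPn; exists v.
rewrite (bigID (fun B : {set T} => v \in B)) /= addrC big_split /=; congr (_ + _).
  apply: eq_bigl => B; have [vB | vB] := boolP (v \in B); last by rewrite andbT subU1.
  by rewrite andbF nsubU.
rewrite -big_mkcondr /=.
rewrite (reindex_onto (fun B => v |: B) (fun B => B :\ v)) /=; last first.
  by move=> B /andP[_ vB]; rewrite setD1K.
apply: eq_bigl => B; rewrite setU11 andbT.
have [vB | vB] := boolP (v \in B).
  rewrite nsubU //= andbC; have [E | //] := eqVneq _ B.
  by rewrite -E setD11 in vB.
rewrite setU1K // eqxx andbT subUset sub1set setU11 subU1 //=.
by have [sBU | //] := boolP (B \subset U); rewrite idealU1.
Qed.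

End Grow.

Section IdealSum.
Variables (R : comNzRingType) (P w : T -> R).
Hypothesis P_rec : forall v,
  P v = w v + if v \in rtree_leaves T then 0 else \prod_(u | chd v u) P u.

(** The state of the expansion of [P r] once the vertices in U are unfolded. *)
Definition explored_sum U : R :=
  \sum_(B : {set T} | (B \subset U) && ideal B)
     \prod_(v in frontier B) if v \in U then w v else P v.

(** Distributing [P v = w v + _] over the product of an ideal B with v on its
    frontier gives the terms of B and of [v |: B]; an ideal without v on its
    frontier has the same term before and after. *)
Lemma explored_sumU1 U v : U \subset reached U -> v \notin U ->
  explored_sum (v |: U) = explored_sum U.
Proof.
move=> U_closed vU; rewrite /explored_sum sum_subsetU1 //.
apply: eq_bigr => B /andP[sBU _].
have gE z : z != v ->
    (if z \in v |: U then w z else P z) = if z \in U then w z else P z.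
  by move=> zv; rewrite in_setU1 (negPf zv).
have [vB | vB] := boolP (v \in frontier B); last first.
  rewrite addr0; apply: eq_bigr => z zB; rewrite gE //.
  by apply: contraNneq vB => <-.
rewrite !(big_setD1 v vB) /= setU11 (negPf vU) P_rec mulrDl.
set Q := \prod_(z in frontier B :\ v) _.
have -> : \prod_(z in frontier B :\ v) (if z \in U then w z else P z) = Q.
  by apply: eq_bigr => z /setD1P[zv _]; rewrite gE.
congr (_ + _); have [_ | _] := boolP (v \in _); first by rewrite mul0r.
rewrite (frontierU1 U_closed) // (eq_bigl _ _ (fun z => in_setU z _ _)) bigU /=; last first.
  rewrite -setI_eq0; apply/eqP/setP=> z; rewrite !inE.
  apply/negP=> /andP[/and3P[_ zB zR] vz].
  by move: vB; rewrite inE -(reached_child B vz) inE zR.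
rewrite mulrC; congr (_ * _); apply: eq_big => [z | z]; rewrite inE // => vz.
rewrite gE; first by rewrite (negPf (childU U_closed vU vz)).
by apply: contraTneq vz => ->; rewrite child_irr.
Qed.

(** The only ideal inside the empty set is empty, with the root as frontier, so
    [explored_sum set0] is [P r]; once all vertices are unfolded only weights
    remain. *)
Lemma root_ideal_sum :
  P r = \sum_(B | ideal B) \prod_(v in frontier B) w v.
Proof.
have start : explored_sum set0 = P r.
  rewrite /explored_sum (big_pred1 set0) => [|B]; last first.
    rewrite subset0; apply: andb_idr => /eqP->.
    by rewrite /ideal sub0set -setI_eq0 set0I eqxx.
  rewrite (big_pred1 r) ?inE // => v; rewrite /frontier setD0 inE pred1E orbC.
  by case: exists_inP => // -[u]; rewrite inE.
have grow U : U \subset reached U -> explored_sum U = explored_sum [set: T].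
  have [n] := ubnP #|~: U|; elim: n U => // n IHn U; rewrite ltnS => le_n U_closed.
  (* A vertex that is reached but not yet unfolded exists unless U is full. *)
  have [/subsetP sRU | /subsetPn[v vR vU]] := boolP (reached U \subset U).
    suff -> : U = [set: T] by [].
    apply/setP=> v; rewrite in_setT; elim/root_ind: v => [|u v uv uU].
      exact/sRU/reached_root.
    by apply: sRU; rewrite (reached_child _ uv) uU.
  rewrite -(explored_sumU1 U_closed vU); apply: IHn.
    apply: leq_trans le_n; apply: proper_card.
    by rewrite properC properUr // sub1set.
  rewrite subUset sub1set (subsetP (reachedS (subsetUr _ _))) //=.
  exact: subset_trans U_closed (reachedS (subsetUr _ _)).
rewrite -start (grow _ (sub0set _)).
apply: eq_big => [B | B _]; first by rewrite subsetT.
by apply: eq_bigr => v _; rewrite in_setT.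
Qed.

End IdealSum.

(** * Subtrees containing the root *)

Section SubgraphLemmas.
Variable S : subgraph T.
Hypotheses (S_sub : is_subgraph S) (S_tree : is_tree S.1 (sub_adj S))
  (S_root : r \in S.1).

Lemma sub_adjC : symmetric (sub_adj S).
Proof. by move=> u v; rewrite /sub_adj setUC. Qed.

Lemma sub_adjW u v : sub_adj S u v -> [/\ u \in S.1, v \in S.1 & adj T u v].
Proof.
move=> uv; have /forall_inP/(_ _ uv)/exists_inP[a aS /exists_inP[b bS]] := S_sub.
case/andP=> ab /eqP E.
have := set22 a b; have := set21 a b; have := set21 u v; rewrite -E {1}E.
case/set2P=> -> /set2P[] Ea /set2P[] Eb; move: ab aS bS; rewrite ?Ea ?Eb ?adj_irr //.
  by rewrite Ea adj_irr.
by rewrite adj_sym.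
Qed.

Lemma sub_simple_path_to v : v \in S.1 ->
  exists p, [/\ path (sub_adj S) r p, path (adj T) r p, uniq (r :: p)
              & last r p = v].
Proof.
have /andP[/forall_inP/(_ r S_root)/forall_inP conn _] := S_tree.
move/conn => /connectP[p rp ->]; case/shortenP: rp => q rq Uq _; exists q.
by split=> //; apply: sub_path rq => a b /sub_adjW[].
Qed.

(** A subtree containing the root is an induced subgraph: the edge to a vertex v
    from its parent is the last edge of the path to v inside the subtree. *)
Lemma sub_adj_child u v : chd u v -> sub_adj S u v = (v \in S.1).
Proof.
move=> uv; apply/idP/idP => [/sub_adjW[] // | /sub_simple_path_to[p [pS pP pU pv]]].
case/lastP: p => [|p x] in pS pP pU pv *.
  by move: uv; rewrite -pv child_root.
rewrite last_rcons in pv; move: pS; rewrite {x}pv in pP pU *.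
rewrite rcons_path => /andP[_].
by rewrite (parent_unique (u' := last r p) uv) //; apply/childP; exists p.
Qed.

Lemma sub_parent u v : chd u v -> v \in S.1 -> u \in S.1.
Proof. by move=> uv; rewrite -(sub_adj_child uv) => /sub_adjW[]. Qed.

Lemma sub_childE u v :
  child (sub_adj S) r u v = chd u v && (v \in S.1).
Proof.
apply/idP/andP=> [/childP[p [pS pU pu]] | [uv vS]].
  have uv : sub_adj S u v by move: pS; rewrite rcons_path pu => /andP[].
  split; last by case/sub_adjW: uv.
  apply/childP; exists p; split=> //.
  by apply: sub_path pS => a b /sub_adjW[].
have [q [qS qP qU qu]] := sub_simple_path_to (sub_parent uv vS).
case/childP: (uv) => p [pP pU pu].
have Ep : p = q.
  move: pP pU; rewrite rcons_path -rcons_cons rcons_uniq => /andP[pP _] /andP[_ pU].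
  by apply: simple_path_to_unique; rewrite ?pu.
apply/childP; exists p; split=> //.
by rewrite rcons_path pu Ep qS sub_adj_child.
Qed.

Lemma sub_leavesP v :
  reflect (v \in S.1 /\ forall u, chd v u -> u \notin S.1)
          (v \in sub_leaves S).
Proof.
rewrite inE; apply: (iffP andP) => -[vS H]; split=> //.
  by move=> u vu; move/forallP/(_ u): H; rewrite sub_childE vu.
by apply/forallP=> u; rewrite sub_childE; apply/andP=> -[/H/negP].
Qed.

(** A subtree is determined by its vertices. *)
Lemma sub_edgesE :
  S.2 = [set [set e.1; e.2] | e in [set e : T * T | chd e.1 e.2 & e.2 \in S.1]].
Proof.
apply/setP=> E; apply/idP/imsetP=> [ES | [[u v] /=]]; last first.
  by rewrite inE /= => /andP[uv vS] ->; rewrite -[_ \in _]/(sub_adj S u v) sub_adj_child.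
have /forall_inP/(_ _ ES)/exists_inP[a aS /exists_inP[b bS]] := S_sub.
case/andP=> /adj_child/orP[ab | ba] /eqP ->.
  by exists (a, b); rewrite // inE ab.
by exists (b, a); rewrite ?inE ?ba //= setUC.
Qed.

End SubgraphLemmas.

(** * Primary subtrees correspond to ideals *)

Definition inner S : {set T} := S.1 :\: sub_leaves S.

Definition subtree_of B : subgraph T :=
  (reached B,
   [set [set e.1; e.2] | e in [set e : T * T | chd e.1 e.2 & e.2 \in reached B]]).

Section IdealToSubtree.
Variable B : {set T}.
Hypothesis B_ideal : ideal B.
Let sB : B \subset reached B. Proof. by case/andP: B_ideal. Qed.

Lemma subtree_of_adj u v :
  chd u v -> u \in B -> sub_adj (subtree_of B) u v.
Proof.
move=> uv uB; apply/imsetP; exists (u, v) => //.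
by rewrite inE /= uv (reached_child _ uv).
Qed.

Lemma subtree_of_subgraph : is_subgraph (subtree_of B).
Proof.
apply/forall_inP=> E /imsetP[[u v]]; rewrite inE /= => /andP[uv vB] ->.
have uB : u \in reached B by apply: (subsetP sB); rewrite -(reached_child _ uv).
apply/exists_inP; exists u => //; apply/exists_inP; exists v => //.
by rewrite child_adj //= eqxx.
Qed.

Lemma subtree_of_tree : is_tree (subtree_of B).1 (sub_adj (subtree_of B)).
Proof.
have eC := sym_connect_sym (sub_adjC (subtree_of B)).
have conn v : v \in reached B -> connect (sub_adj (subtree_of B)) r v.
  elim/root_ind: v => [|u v uv IH]; first by rewrite connect0.
  rewrite (reached_child _ uv) => uB.
  apply: connect_trans (IH (subsetP sB _ uB)) _.
  exact/connect1/subtree_of_adj.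
apply/andP; split.
  apply/forall_inP=> u uB; apply/forall_inP=> v vB.
  by apply: connect_trans (conn v vB); rewrite eC conn.
have /andP[_ /acyclicP T_acyclic] := adj_tree T.
apply/acyclicP=> c /andP[cP cU]; apply: T_acyclic; apply/andP; split=> //.
apply: sub_cycle cP => u v.
by case/(sub_adjW subtree_of_subgraph).
Qed.

Lemma subtree_of_leaves : sub_leaves (subtree_of B) = frontier B.
Proof.
apply/setP=> v.
apply/(sub_leavesP subtree_of_subgraph subtree_of_tree (reached_root B))/setDP.
  move=> [/= vB vL]; split=> //; apply/negP=> vinB.
  have /internalP[u vu] : v \notin rtree_leaves T.
    by case/andP: B_ideal => _ /disjointFr ->.
  by move/negP: (vL u vu); rewrite (reached_child _ vu).
by case=> vB vN; split=> // u vu; rewrite /= (reached_child _ vu).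
Qed.

(** A path from the root down to a leaf of T cannot stay in B, which consists of
    internal vertices; its first vertex outside B lies on the frontier. *)
Lemma subtree_of_primary : primary (subtree_of B).
Proof.
apply/and4P; split; [exact: subtree_of_subgraph | exact: subtree_of_tree
  | exact: reached_root |].
have covered v : (v \in B) ||
    [exists u in frontier B, descendant (adj T) r u v].
  elim/root_ind: v => [|u v uv].
    have [// | rB] := boolP (r \in B); apply/exists_inP; exists r.
      by rewrite inE rB reached_root.
    exact: connect0.
  have [// | vB] := boolP (v \in B); case/orP=> [uB | /exists_inP[a aB au]].
    apply/exists_inP; exists v; last exact: connect0.
    by rewrite inE vB (reached_child _ uv).
  apply/exists_inP; exists a => //.
  exact: connect_trans au (connect1 uv).
apply/forall_inP=> v vL; rewrite subtree_of_leaves; apply/orP; right.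
have := covered v; case/andP: B_ideal => _ /disjointFl -> //.
Qed.

End IdealToSubtree.

Section SubtreeToIdeal.
Variable S : subgraph T.
Hypothesis S_primary : primary S.
Let S_sub : is_subgraph S. Proof. by case/and4P: S_primary. Qed.
Let S_tree : is_tree S.1 (sub_adj S). Proof. by case/and4P: S_primary. Qed.
Let S_root : r \in S.1. Proof. by case/and4P: S_primary. Qed.

Lemma innerP v :
  reflect (exists2 u, chd v u & u \in S.1) (v \in inner S).
Proof.
have s_leafP := sub_leavesP S_sub S_tree S_root v.
apply: (iffP idP) => [/setDP[vS /s_leafP vL] | [u vu uS]].
  have [/existsP[u /andP[]] | ] := boolP [exists u, chd v u && (u \in S.1)].
    by exists u.
  rewrite negb_exists => /forallP H; case: vL; split=> // u vu.
  by have := H u; rewrite vu.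
apply/setDP; split; first exact: sub_parent vu uS.
by apply/s_leafP=> -[_ /(_ u vu)/negP].
Qed.

(** This is where primality is used. If the child v of u were missing, then v
    would be bad: outside S and with no leaf of S above it, since u and its
    ancestors all have a child in S. Children of a bad vertex are bad, as a leaf
    of S above one of them would be that child itself, hence in S together with
    its parent, or lie above the parent. So some leaf of T would be bad. *)
Lemma inner_child u v : u \in inner S -> chd u v -> v \in S.1.
Proof.
move=> /innerP[u' uu' u'S] uv; apply/negPn/negP=> vS.
pose bad x := (x \notin S.1) &&
  ~~ [exists a in sub_leaves S, descendant (adj T) r a x].
have s_leafP a : a \in sub_leaves S -> a \in S.1 /\ forall b, chd a b -> b \notin S.1.
  by move/(sub_leavesP S_sub S_tree S_root).
have anc a b : descendant (adj T) r a b -> b \in S.1 -> a \in S.1.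
  case/connectP=> p ap -> {b}; elim: p a ap => //= b p IHp a /andP[ab bp] /(IHp b bp).
  exact: sub_parent.
have desc_parent a x y : descendant (adj T) r a y -> chd x y ->
    a = y \/ descendant (adj T) r a x.
  case/connectP=> p; case/lastP: p => [|p z] /=; first by left.
  rewrite last_rcons rcons_path => /andP[ap pz] Ez xy; right.
  rewrite -{z}Ez in pz; rewrite (parent_unique xy pz).
  by apply/connectP; exists p.
have: bad v.
  rewrite /bad vS; apply/exists_inP=> -[a aL av]; have [aS a_leaf] := s_leafP a aL.
  have [Eav | au] := desc_parent _ _ _ av uv; first by rewrite -Eav aS in vS.
  case/connectP: au => -[_ Eu | b p /= /andP[ab bp] Eu].
    by rewrite Eu in uu'; have := a_leaf u' uu'; rewrite u'S.
  have /negP[] := a_leaf b ab; apply: (anc _ u).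
    by apply/connectP; exists p.
  exact: sub_parent uu' u'S.
elim/leaf_ind: v {uv vS} => v IHv /andP[vS vL].
have [/existsP[x vx] | ] := boolP [exists x, chd v x].
  apply: (IHv x vx); apply/andP; split.
    by apply: contra vS; apply: sub_parent.
  apply: contra vL => /exists_inP[a aL ax]; apply/exists_inP; exists a => //.
  have [Eax | //] := desc_parent _ _ _ ax vx.
  have [aS _] := s_leafP a aL; case/negP: vS; rewrite Eax in aS.
  exact: sub_parent vx aS.
rewrite negb_exists => /forallP v_leaf.
case/and4P: S_primary => _ _ _ /forall_inP/(_ v).
case/(_ _)/orP=> [| /s_leafP[] | cov]; first exact/leafP.
  by rewrite (negPf vS).
by case/negP: vL.
Qed.

Lemma inner_ideal : ideal (inner S).
Proof.
apply/andP; split.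
  apply/subsetP=> v; elim/root_ind: v => [|u v uv _ vS]; first by rewrite reached_root.
  by rewrite (reached_child _ uv); apply/innerP; exists v => //; case/setDP: vS.
rewrite disjoint_subset; apply/subsetP=> v /innerP[u vu _].
by apply/internalP; exists u.
Qed.

Lemma reached_inner : reached (inner S) = S.1.
Proof.
apply/setP=> v; elim/root_ind: v => [|u v uv _]; first by rewrite reached_root S_root.
rewrite (reached_child _ uv); apply/idP/idP=> [uS | vS].
  exact: inner_child uv.
by apply/innerP; exists v.
Qed.

Lemma subtree_of_inner : subtree_of (inner S) = S.
Proof.
by rewrite /subtree_of reached_inner -(sub_edgesE S_sub S_tree S_root); case: (S).
Qed.

End SubtreeToIdeal.

Lemma inner_subtree_of B : ideal B -> inner (subtree_of B) = B.
Proof.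
move=> B_ideal; rewrite /inner subtree_of_leaves // setDDr setDv set0U.
by apply/setIidPr; case/andP: B_ideal.
Qed.

Lemma frontier_monomial B :
  varx ^+ #|frontier B :&: rtree_leaves T|
    * vary ^+ #|frontier B :\: rtree_leaves T| =
  \prod_(v in frontier B) if v \in rtree_leaves T then varx else vary.
Proof.
rewrite (big_setID (rtree_leaves T)) /= -!prodr_const; congr (_ * _).
  by apply: eq_bigr => v /setIP[_ ->].
by apply: eq_bigr => v /setDP[_ /negPf->].
Qed.

End RootedTree.

Theorem lemma2p4 (T : rootedTree) :
  tree_poly T = \sum_(S in primary_subtrees T) subtree_monomial S.
Proof.
rewrite (reindex_onto (@subtree_of T) (@inner T)) /=; last first.
  by move=> S; rewrite inE => /subtree_of_inner.
rewrite /tree_poly (@root_ideal_sum T _ (@tree_poly_at T #|T|)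
  (fun v => if v \in rtree_leaves T then varx else vary)); last first.
  by move=> v; rewrite tree_poly_at_rec; case: ifP; rewrite ?addr0.
apply: eq_big => [B | B B_ideal].
  rewrite inE; apply/idP/andP => [B_ideal | [S_primary /eqP <-]].
    by rewrite subtree_of_primary // inner_subtree_of.
  exact: inner_ideal.
by rewrite /subtree_monomial subtree_of_leaves // frontier_monomial.
Qed.
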